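(* (Fusion rule.) Let $L$ be a frame, let $(P;e)$ and $(Q;e')$ be two $L$-complete lattices and let $f:P\to Q$ possess a (fuzzy) right adjoint $f':Q\to P$. Let $g:P\to P$ and $h:Q\to Q$ be monotone. Then (i) $\bigwedge_{y\in P}e'\big(f\circ g(y),h\circ f(y)\big)\le e'\big(f(\sqcap S_g),\sqcap S_h\big)$. (ii) $e'\big(h\circ f(\sqcap S_g),f\circ g(\sqcap S_g)\big)\le e'\big(\sqcap S_h,f(\sqcap S_g)\big)$.
   Context: A frame is a complete lattice $L$ (with bottom $0$, top $1$) satisfying $a\wedge\bigvee S=\bigvee_{s\in S}(a\wedge s)$ for all $a\in L$, $S\subseteq L$; its relative pseudocomplement is $a\to b=\bigvee\{x\in L\mid a\wedge x\le b\}$. $L^P$ is the set of all maps $P\to L$. An $L$-ordered set is a pair $(P;e)$ with $P$ a set and $e:P\times P\to L$ a map such that for all $x,y,z\in P$: (E1) $e(x,x)=1$; (E2) $e(x,y)\wedge e(y,z)\le e(x,z)$; (E3) $e(x,y)=e(y,x)=1$ implies $x=y$. For $S\in L^P$, an element $x_0\in P$ is the join of $S$, written $x_0=\sqcup S$, if for all $x\in P$: $S(x)\le e(x,x_0)$ and $\bigwedge_{y\in P}(S(y)\to e(y,x))\le e(x_0,x)$. It is the meet, $x_0=\sqcap S$, if for all $x\in P$: $S(x)\le e(x_0,x)$ and $\bigwedge_{y\in P}(S(y)\to e(x,y))\le e(x,x_0)$. Joins and meets are unique when they exist. $(P;e)$ is an $L$-complete lattice if $\sqcup S$ and $\sqcap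 S$ exist for every $S\in L^P$. A map $f:(P;e)\to(Q;e')$ is monotone if $e(x,y)\le e'(f(x),f(y))$ for all $x,y\in P$. The map $f':Q\to P$ is a (fuzzy) right adjoint of $f:P\to Q$ if both $f$ and $f'$ are monotone and $e'(f(x),y)=e(x,f'(y))$ for all $x\in P$, $y\in Q$. For a self-map $k$ of an $L$-ordered set $(X;e_X)$, $S_k:X\to L$ is defined by $S_k(x)=e_X(k(x),x)$. *)

(* Defs.v *)
From HB Require Import structures.
From mathcomp Require Import all_boot all_order.
From mathcomp Require Import boolp classical_sets.

Set Implicit Arguments.
Unset Strict Implicit.
Unset Printing Implicit Defensive.

Import Order.TTheory.
Local Open Scope classical_set_scope.
Local Open Scope order_scope.

(* Join is determined by the order, so taking it as data is the same as requiring
   every subset to have a supremum.  The boolean order and choice structure of L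
   are no restriction: boolp provides them on every type. *)
HB.mixin Record TBLattice_isFrame (d : Order.disp_t) L of Order.TBLattice d L := {
  Join : set L -> L ;
  Join_supremums : forall S : set L, supremums S (Join S) ;
  meet_Join : forall (a : L) (S : set L),
    a `&` Join S = Join [set a `&` s | s in S]
}.

#[short(type="frameType")]
HB.structure Definition Frame (d : Order.disp_t) :=
  { L of TBLattice_isFrame d L & Order.TBLattice d L }.

Section FrameOperations.
Context {d : Order.disp_t} {L : frameType d}.

Definition Meet (S : set L) : L := Join (lbound S).

Lemma Meet_infimums (S : set L) : infimums S (Meet S).
Proof.
have [ub lub] := Join_supremums (lbound S).
by split => [x Sx | x lbx]; [apply: lub => y; exact | exact: ub].
Qed.

Definition imp (a b : L) : L := Join [set x | a `&` x <= b].

Lemma imp_adj (a b x : L) : (a `&` x <= b) = (x <= imp a b).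
Proof.
have [ub lub] := Join_supremums [set x | a `&` x <= b].
apply/idP/idP => [|le]; first exact: ub.
apply: (le_trans (leI2 (lexx a) le)); rewrite /imp meet_Join.
by have [_] := Join_supremums [set a `&` s | s in [set x | a `&` x <= b]];
  apply => _ [y /= le' <-].
Qed.

End FrameOperations.

HB.mixin Record isLOrdered (d : Order.disp_t) (L : frameType d) P := {
  lrel : P -> P -> L ;
  lrel_refl : forall x, lrel x x = \top ;
  lrel_trans : forall x y z, lrel x y `&` lrel y z <= lrel x z ;
  lrel_anti : forall x y, lrel x y = \top -> lrel y x = \top -> x = y
}.

#[short(type="lOrderedType")]
HB.structure Definition LOrdered (d : Order.disp_t) (L : frameType d) :=
  { P of isLOrdered d L P }.

Section LOrderedNotions.
Context {d : Order.disp_t} {L : frameType d}.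

Definition is_ljoin {P : lOrderedType L} (S : P -> L) (x0 : P) : Prop :=
  forall x, S x <= lrel x x0 /\
    Meet (range (fun y => imp (S y) (lrel y x))) <= lrel x0 x.

Definition is_lmeet {P : lOrderedType L} (S : P -> L) (x0 : P) : Prop :=
  forall x, S x <= lrel x0 x /\
    Meet (range (fun y => imp (S y) (lrel x y))) <= lrel x x0.

Definition lmonotone {P Q : lOrderedType L} (f : P -> Q) : Prop :=
  forall x y, lrel x y <= lrel (f x) (f y).

Definition is_right_adjoint {P Q : lOrderedType L} (f : P -> Q) (f' : Q -> P) :
    Prop :=
  [/\ lmonotone f, lmonotone f' & forall x y, lrel (f x) y = lrel x (f' y)].

(* S_k : the L-set of points x with k x "below" x. *)
Definition prefix_lset {P : lOrderedType L} (k : P -> P) : P -> L :=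
  fun x => lrel (k x) x.

Lemma is_lmeet_unique (P : lOrderedType L) (S : P -> L) (x0 x1 : P) :
  is_lmeet S x0 -> is_lmeet S x1 -> x0 = x1.
Proof.
have aux (y0 y1 : P) : is_lmeet S y0 -> is_lmeet S y1 -> lrel y0 y1 = \top.
  move=> m0 m1; apply/eqP; rewrite -le1x; have [_ le1] := m1 y0.
  apply: le_trans le1; have [_ inf] := Meet_infimums
    (range (fun y => imp (S y) (lrel y0 y))).
  by apply: inf => _ [y _ <-]; rewrite -imp_adj meetx1; have [] := m0 y.
by move=> m0 m1; apply: lrel_anti; apply: aux.
Qed.

End LOrderedNotions.

HB.mixin Record LOrdered_isComplete (d : Order.disp_t) (L : frameType d) P
    of LOrdered d L P := {
  ex_ljoin : forall S : P -> L, exists x0 : P, is_ljoin S x0 ;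
  ex_lmeet : forall S : P -> L, exists x0 : P, is_lmeet S x0
}.

#[short(type="lCompleteLatticeType")]
HB.structure Definition LCompleteLattice (d : Order.disp_t) (L : frameType d) :=
  { P of LOrdered_isComplete d L P & LOrdered d L P }.

(* Meets exist as a property only; by is_lmeet_unique the chosen one is the meet. *)
Definition lmeet {d : Order.disp_t} {L : frameType d}
  {P : lCompleteLatticeType L} (S : P -> L) : P := sval (cid (ex_lmeet S)).

Lemma lmeetP (d : Order.disp_t) (L : frameType d) (P : lCompleteLatticeType L)
  (S : P -> L) : is_lmeet S (lmeet S).
Proof. exact: svalP (cid (ex_lmeet S)). Qed.

(* Main.v *)
(** The meet m of S_g is an exact prefixed point of g, and S_g(x) <= e(m, x)
    says that it is the least one to degree S_g(x).  Part (ii) applies this to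
    S_h at f m.  For (i), with n the meet of S_h, transpose e'(f m, n) to
    e(m, f' n) >= S_g(f' n) = e'(f g f' n, n), and go from f g f' n to n through
    h f f' n and h n, using the counit f f' n <= n. *)
Require Import Defs.
From HB Require Import structures.
From mathcomp Require Import all_boot all_order.
From mathcomp Require Import boolp classical_sets.

Set Implicit Arguments.
Unset Strict Implicit.
Unset Printing Implicit Defensive.

Import Order.TTheory.
Local Open Scope classical_set_scope.
Local Open Scope order_scope.

Section PrefixMeet.
Context {d : Order.disp_t} {L : frameType d}.

Lemma lrel_trans1l (P : lOrderedType L) (x y z : P) :
  lrel x y = \top -> lrel y z <= lrel x z.
Proof. by move=> xy; have := lrel_trans x y z; rewrite xy meet1x. Qed.

Lemma lrel_trans1r (P : lOrderedType L) (x y z : P) :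
  lrel y z = \top -> lrel x y <= lrel x z.
Proof. by move=> yz; have := lrel_trans x y z; rewrite yz meetx1. Qed.

Lemma lmonotone_top (P Q : lOrderedType L) (f : P -> Q) (x y : P) :
  lmonotone f -> lrel x y = \top -> lrel (f x) (f y) = \top.
Proof. by move=> f_mono xy; apply/eqP; rewrite -le1x -xy; exact: f_mono. Qed.

(** The Knaster-Tarski argument in degrees: [k m] is a lower bound of S_k, since S_k(x) <= e(m, x)
    <= e(k m, k x) and S_k(x) is itself e(k x, x), so transitivity gives S_k(x) <= e(k m, x). *)
Lemma lmeet_prefix_prefixed (P : lOrderedType L) (k : P -> P) (m : P) :
  lmonotone k -> is_lmeet (prefix_lset k) m -> lrel (k m) m = \top.
Proof.
move=> k_mono m_meet; apply/eqP; rewrite -le1x.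
have [_] := m_meet (k m); apply: le_trans.
have [_ inf] := Meet_infimums
  (range (fun y => imp (prefix_lset k y) (lrel (k m) y))).
apply: inf => _ [x _ <-]; rewrite -imp_adj meetx1.
apply: le_trans (lrel_trans (k m) (k x) x).
rewrite lexI lexx andbT; apply: le_trans (k_mono m x).
by have [] := m_meet x.
Qed.

End PrefixMeet.

Theorem theorem3p10 (d : Order.disp_t) (L : frameType d)
    (P Q : lCompleteLatticeType L) (f : P -> Q) (f' : Q -> P)
    (f_adj : is_right_adjoint f f')
    (g : P -> P) (g_mono : lmonotone g) (h : Q -> Q) (h_mono : lmonotone h) :
  Meet (range (fun y : P => lrel ((f \o g) y) ((h \o f) y)))
    <= lrel (f (lmeet (prefix_lset g))) (lmeet (prefix_lset h))
  /\
  lrel ((h \o f) (lmeet (prefix_lset g))) ((f \o g) (lmeet (prefix_lset g)))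
    <= lrel (lmeet (prefix_lset h)) (f (lmeet (prefix_lset g))).
Proof.
have [f_mono _ adj] := f_adj.
have m_meet := lmeetP (prefix_lset g); have n_meet := lmeetP (prefix_lset h).
set m := lmeet (prefix_lset g) in m_meet *.
set n := lmeet (prefix_lset h) in n_meet *.
have gm := lmeet_prefix_prefixed g_mono m_meet.
have hn := lmeet_prefix_prefixed h_mono n_meet.
split.
- have counit : lrel (f (f' n)) n = \top by rewrite adj lrel_refl.
  rewrite adj; have [+ _] := m_meet (f' n); apply: le_trans.
  rewrite /prefix_lset -adj.
  (* The links h n <= n and h f f' n <= h n hold to degree [\top], so they cost nothing; what
     remains is the term y = f' n of the meet. *)
  apply: le_trans (lrel_trans1r _ hn).
  apply: le_trans (lrel_trans1r _ (lmonotone_top h_mono counit)).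
  by have [lb _] := Meet_infimums
    (range (fun y => lrel ((f \o g) y) ((h \o f) y))); apply: lb; exists (f' n).
- have [+ _] := n_meet (f m); apply: le_trans.
  (* The target is S_h(f m) = e(h f m, f m), and f g m <= f m holds to degree [\top]. *)
  exact: lrel_trans1r (lmonotone_top f_mono gm).
Qed.
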